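(* Let $r\ge 1$ be an integer and let $G_r$ be the finite hexagonal grid of radius $r$, viewed as a graph in its own right. For every subset $W\subseteq V(G_r)$ with $|W|\le \tfrac12|V(G_r)|$ we have, with neighbors, outgoing edges and boundary taken in $G_r$: (1) $|\mathcal{N}(W)|\ge c\sqrt{|W|}$ for $c=0.6053$; (2) $|\mathcal{E}(W)|\ge c\sqrt{|W|}$ for $c=\sqrt6-\sqrt3$; (3) $|\mathcal{B}(W)|\ge c\sqrt{|W|+\tfrac14c^2}-\tfrac12c^2$ for $c=0.6053$. Furthermore, for every $c<\sqrt6-\sqrt3$ there exists $R_c\in\mathbb{N}$ such that for all integers $r\ge R_c$ and all $W\subseteq V(G_r)$ with $|W|\le\tfrac12|V(G_r)|$: (4) $|\mathcal{N}(W)|\ge c\sqrt{|W|}$; (5) $|\mathcal{B}(W)|\ge c\sqrt{|W|+\tfrac14c^2}-\tfrac12c^2$.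
   Context: The infinite hexagonal grid $G_\infty$ is the graph formed by the vertices and edges of the tiling of the plane by regular hexagons (three hexagons meet at each vertex). The finite hexagonal grid $G_r$ of radius $r$ is defined inductively as a subgraph of $G_\infty$: $G_1$ is a single hexagon of the tiling (a 6-cycle); $G_r$ consists of all vertices and edges of $G_{r-1}$ together with all vertices and edges of the layer of hexagons of the tiling surrounding $G_{r-1}$ (so $|V(G_r)|=6r^2$). For a graph $G=(V,E)$ and $W\subseteq V$: $\mathcal{N}(W)=\{x\in V\setminus W : \{x,y\}\in E \text{ for some } y\in W\}$, $\mathcal{B}(W)=\{x\in W : \{x,y\}\in E \text{ for some } y\in V\setminus W\}$, and $\mathcal{E}(W)=\{\{x,y\}\in E : x\in W,\ y\in V\setminus W\}$; here $G=G_r$. *)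

(* Defs.v *)
From mathcomp Require Import all_boot all_order all_algebra.
From mathcomp Require Import finmap.
From mathcomp Require Import reals.

Set Implicit Arguments.
Unset Strict Implicit.
Unset Printing Implicit Defensive.

Import GRing.Theory.
Local Open Scope fset_scope.

(* A finite simple graph inside a type T of potential vertices; an edge is    *)
(* the two-element set of its ends.                                           *)
Record fgraph (T : choiceType) := FGraph {
  vertices : {fset T};
  edges : {fset {fset T}}
}.

Section Boundaries.
Variables (T : choiceType) (G : fgraph T) (W : {fset T}).

Definition nbrs : {fset T} :=
  [fset x in vertices G `\` W | [exists y : W, [fset x; val y] \in edges G]].

Definition bdry : {fset T} :=
  [fset x in W | [exists y : vertices G `\` W, [fset x; val y] \in edges G]].

Definition out_edges : {fset {fset T}} :=
  [fset e in edges G |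
    [exists x : W, exists y : vertices G `\` W, e == [fset val x; val y]]].

End Boundaries.

(* The pair (a, b) stands for the point a + b z of the plane, z = exp(i pi/3) *)
(* so that these points form the triangular lattice.  The regular hexagons    *)
(* of side 1 centred at the lattice points a + b z with a = b mod 3, with     *)
(* corners the centre plus each power of z, tile the plane.                   *)
Notation point := (int * int)%type.

(* z ^ k; note that z ^ 2 = z - 1 *)
Definition dir (k : 'I_6) : point :=
  nth (0, 0)%R
    [:: (1, 0); (0, 1); (-1, 1); (-1, 0); (0, -1); (1, -1)]%R k.

Definition is_center (c : point) : bool := (3%:Z %| (c.1 - c.2)%R)%Z.

Definition corner (c : point) (k : 'I_6) : point :=
  (c.1 + (dir k).1, c.2 + (dir k).2)%R.

Definition hexagon (c : point) : fgraph point :=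
  FGraph [fset corner c k | k in 'I_6]
         [fset [fset corner c k; corner c (ordS k)] | k in 'I_6].

(* The centres of the hexagons of the tiling having v as a corner *)
Definition centers_at (v : point) : {fset point} :=
  [fset c in [fset (v.1 - (dir k).1, v.2 - (dir k).2)%R | k in 'I_6]
     | is_center c].

(* The hexagons of the tiling that meet G (those already in G included, which *)
(* is harmless in add_layer)                                                  *)
Definition layer (G : fgraph point) : {fset point} :=
  \bigcup_(v <- vertices G) centers_at v.

Definition add_layer (G : fgraph point) : fgraph point :=
  FGraph (vertices G `|` \bigcup_(c <- layer G) vertices (hexagon c))
         (edges G `|` \bigcup_(c <- layer G) edges (hexagon c)).

(* The grid of radius r >= 1; the value at r = 0 is meaningless *)
Definition hexgrid (r : nat) : fgraph point :=
  iter r.-1 add_layer (hexagon (0, 0)%R).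

(* Main.v *)
(** All five inequalities follow from 10 |W| <= 19 |N(W)|^2, valid for every radius.

   G_r is covered by three families of 2r zigzag rows.  A row meeting both W and
   its complement W' contains a point of N(W), and rows of one family are disjoint,
   so each family has at most M = |N(W)| mixed rows.
   - If two families have no row inside W, then W lies over at most M x M pairs of
     mixed rows, two vertices each, so |W| <= 2 M^2; the constant is improved with
     the third family, whose indices are determined by the sum of the other two, or,
     if that family has a row inside W, with the corner of the M x M square that
     falls outside the grid.  The case of W' is symmetric, as |W| <= |W'|.
   - Otherwise either all rows of some family are mixed, or some family has both a
     full and an empty row, another one a full row and the third an empty row; in
     both cases M >= 2r, while |W| <= 4 r^2.

   Part (2) follows from |E(W)| >= |N(W)|, and the bounds on B = B(W) from the
   inequality for W \ B, whose neighbours all lie in B. *)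
Require Import Defs.
From mathcomp Require Import all_boot all_order all_algebra.
From mathcomp Require Import finmap.
From mathcomp Require Import reals.
From mathcomp Require Import boolp zify lra.

Set Implicit Arguments.
Unset Strict Implicit.
Unset Printing Implicit Defensive.

Local Open Scope fset_scope.
Local Open Scope nat_scope.

(** * Counting finite sets through injections and surjections *)

(** The list [d] collects values known to be missed by [f]. It later removes from a product of
    projections the corner lying outside the grid. *)
Lemma card_inj_disjoint_leq (T : choiceType) (U : eqType) (f : T -> U)
    (S : {fset T}) (s d : seq U) :
  {in S &, injective f} -> {in S, forall v, f v \in s} ->
  uniq d -> {subset d <= s} -> {in S, forall v, f v \notin d} ->
  #|` S| + size d <= size s.
Proof.
move=> f_inj fS d_uniq dS fD.
rewrite -(size_map f) -size_cat; apply: uniq_leq_size.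
  rewrite cat_uniq d_uniq andbT map_inj_in_uniq ?fset_uniq //=.
  by apply/hasPn => u d_u; apply/mapP => -[v vS E]; move/negP: (fD v vS); rewrite -E.
by move=> u; rewrite mem_cat => /orP[/mapP[v vS ->]|/dS //]; apply: fS.
Qed.

Lemma card_inj_leq (T : choiceType) (U : eqType) (f : T -> U)
    (S : {fset T}) (s : seq U) :
  {in S &, injective f} -> {in S, forall v, f v \in s} -> #|` S| <= size s.
Proof.
by move=> f_inj fS; rewrite -[#|`_|]addn0; apply: (@card_inj_disjoint_leq _ _ f _ _ [::]).
Qed.

Lemma card_surj_geq (T : choiceType) (U : eqType) (f : T -> U)
    (Q : {fset T}) (s : seq U) :
  uniq s -> {in s, forall u, exists2 v, v \in Q & f v = u} -> size s <= #|` Q|.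
Proof.
move=> s_uniq fQ; rewrite -[#|`_|](size_map f); apply: uniq_leq_size => // u us.
by have [v vQ <-] := fQ u us; apply: map_f.
Qed.

Lemma argmax_in (T : choiceType) (S : {fset T}) (x : T -> nat) :
  S != fset0 -> exists2 v, v \in S & {in S, forall u, x u <= x v}.
Proof.
case/fset0Pn => v0 v0S.
have [/= [v vS] _ Hv] := @arg_maxnP S [` v0S] xpredT (fun u => x (val u)) isT.
by exists v => // u uS; apply: (Hv [` uS]).
Qed.

Lemma argmin_in (T : choiceType) (S : {fset T}) (x : T -> nat) :
  S != fset0 -> exists2 v, v \in S & {in S, forall u, x v <= x u}.
Proof.
case/fset0Pn => v0 v0S.
have [/= [v vS] _ Hv] := @arg_minnP S [` v0S] xpredT (fun u => x (val u)) isT.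
by exists v => // u uS; apply: (Hv [` uS]).
Qed.

Lemma size_filter_predC1 (a : nat) (s : seq nat) :
  a \in s -> size (filter (predC1 a) s) < size s.
Proof.
move=> aS; rewrite size_filter -(count_predC (pred1 a)).
by rewrite -[X in X < _]add0n ltn_add2r -has_count has_pred1.
Qed.

(* On the L-shaped part of S where x is maximal or y is minimal, x + y, hence z,
   is injective: it contributes at most #|C|, and removing it shrinks A and B. *)
Lemma card_sum_in_leq (T : choiceType) (s : nat) (x y z : T -> nat) (C : seq nat)
    (t : nat) (S : {fset T}) (A B : seq nat) :
  {in S, forall v, x v + y v + z v = s} ->
  {in S &, forall u v, x u = x v -> y u = y v -> u = v} ->
  {in S, forall v, x v \in A} -> {in S, forall v, y v \in B} ->
  {in S, forall v, z v \in C} ->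
  #|` S| <= t * size C + (size A - t) * (size B - t).
Proof.
elim: t S A B => [|t IH] S A B sumS injS SA SB SC.
  rewrite !subn0 add0n -(size_allpairs pair A B).
  apply: (@card_inj_leq _ _ (fun v => (x v, y v))).
    by move=> u v uS vS [xuv yuv]; apply: injS.
  by move=> v vS; apply/allpairsP; exists (x v, y v); rewrite SA ?SB.
have [->|S0] := eqVneq S fset0; first by rewrite cardfs0.
have [a aS a_max] := @argmax_in _ S x S0; have [b bS b_min] := @argmin_in _ S y S0.
pose P v := (x v == x a) || (y v == y b).
pose S1 := [fset v in S | P v]; pose S2 := [fset v in S | ~~ P v].
have cardS : #|` S| <= #|` S1| + #|` S2|.
  rewrite -cardfsUI; apply: leq_trans (leq_addr _ _); apply: fsubset_leq_card.
  by apply/fsubsetP => v vS; rewrite !inE vS /=; case: (P v).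
have cardS1 : #|` S1| <= size C.
  apply: (@card_inj_leq _ _ z) => [u v|v]; rewrite !inE /=; last first.
    by case/andP=> vS _; apply: SC.
  move=> /andP[uS Pu] /andP[vS Pv] zuv.
  move: (sumS u uS) (sumS v vS) (a_max u uS) (a_max v vS) (b_min u uS) (b_min v vS).
  by move=> /= *; apply: injS => //; move: Pu Pv; rewrite /P => *; lia.
have cardS2 : #|` S2| <= t * size C + (size (filter (predC1 (x a)) A) - t) *
                                       (size (filter (predC1 (y b)) B) - t).
  apply: IH => [v|u v|v|v|v]; rewrite !inE /= ?mem_filter /=.
  - by case/andP => vS _; apply: sumS.
  - by case/andP => uS _ /andP[vS _]; apply: injS.
  - by case/andP => vS; rewrite /P negb_or => /andP[-> _]; apply: SA.
  - by case/andP => vS; rewrite /P negb_or => /andP[_ ->]; apply: SB.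
  - by case/andP => vS _; apply: SC.
move: cardS2 (size_filter_predC1 (SA a aS)) (size_filter_predC1 (SB b bS)).
move: (size (filter _ A)) (size (filter _ B)) => fA fB cardS2 ltA ltB.
apply: leq_trans cardS _; apply: leq_trans (leq_add cardS1 cardS2) _.
rewrite mulSn -addnA leq_add2l leq_add2l; apply: leq_mul; lia.
Qed.

(** * Coordinates on a hexagonal grid *)

(* The zigzag paths of the grid of radius r form three families of 2 r parallel
   rows; x, y and z number the rows through a vertex.  The two possible values of
   x + y + z are the two classes of the bipartition. *)
Record hexcoords (T : choiceType) (G : Defs.fgraph T) (r : nat) (x y z : T -> nat) : Prop :=
  HexCoords {
  hex_bound : {in vertices G, forall v,
    [/\ x v < 2 * r, y v < 2 * r, z v < 2 * r &
        (x v + y v + z v).+1 = 3 * r \/ (x v + y v + z v).+2 = 3 * r]};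
  hex_surj : forall i j k, i < 2 * r -> j < 2 * r -> k < 2 * r ->
    (i + j + k).+1 = 3 * r \/ (i + j + k).+2 = 3 * r ->
    exists2 v, v \in vertices G & [/\ x v = i, y v = j & z v = k];
  hex_inj : {in vertices G &, forall u v, x u = x v -> y u = y v -> z u = z v -> u = v};
  hex_adj : {in vertices G &, forall u v, u != v ->
    [\/ x u = x v /\ y u = y v, y u = y v /\ z u = z v | x u = x v /\ z u = z v] ->
    [fset u; v] \in edges G}
}.

Arguments hex_surj {T G r x y z} _ i j k.

Lemma hexcoords_rot T G r x y z :
  @hexcoords T G r x y z -> hexcoords G r y z x.
Proof.
case=> bnd surj inj adj; split.
- by move=> v /bnd[]; split=> //; lia.
- move=> i j k ilt jlt klt s; have [||||v vG [? ? ?]] := surj k i j; try lia.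
  by exists v.
- by move=> u v uG vG ? ? ?; apply: inj.
- move=> u v uG vG uv H; apply: adj => //.
  by case: H => -[? ?]; [constructor 2|constructor 3|constructor 1].
Qed.

Lemma hexcoords_swap T G r x y z :
  @hexcoords T G r x y z -> hexcoords G r y x z.
Proof.
case=> bnd surj inj adj; split.
- by move=> v /bnd[]; split=> //; lia.
- move=> i j k ilt jlt klt s; have [||||v vG [? ? ?]] := surj j i k; try lia.
  by exists v.
- by move=> u v uG vG ? ? ?; apply: inj.
- move=> u v uG vG uv H; apply: adj => //.
  by case: H => -[? ?]; [constructor 1|constructor 3|constructor 2].
Qed.

(** This is the half turn of the grid: it reverses the numbering of each family and exchanges the
    two classes of the bipartition. *)
Lemma hexcoords_opp T G r x y z : @hexcoords T G r x y z ->
  hexcoords G r (fun v => 2 * r - (x v).+1) (fun v => 2 * r - (y v).+1)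
                (fun v => 2 * r - (z v).+1).
Proof.
case=> bnd surj inj adj; split.
- by move=> v /bnd[]; split=> //; lia.
- move=> i j k ilt jlt klt s.
  have [||||v vG [? ? ?]] := surj (2 * r - i.+1) (2 * r - j.+1) (2 * r - k.+1); try lia.
  by exists v => //; split; lia.
- by move=> u v uG vG ? ? ?; case: (bnd u uG) (bnd v vG) => ? ? ? ? [? ? ? ?]; apply: inj => //; lia.
- move=> u v uG vG uv H; case: (bnd u uG) (bnd v vG) => ? ? ? ? [? ? ? ?].
  apply: adj => //.
  by case: H => -[? ?]; [constructor 1|constructor 2|constructor 3]; split; lia.
Qed.

(** * Finding neighbours of a set along rows *)

Lemma nbrsP (T : choiceType) (G : Defs.fgraph T) (W : {fset T}) (v : T) :
  reflect [/\ v \in vertices G, v \notin W &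
              exists2 u, u \in W & [fset v; u] \in edges G]
          (v \in nbrs G W).
Proof.
rewrite /nbrs !inE /=; apply: (iffP andP) => [[/andP[vW vG] /existsP[u uv]]|].
  by split=> //; exists (val u); rewrite ?fsvalP.
by case=> vG vW [u uW uv]; rewrite vW vG; split=> //; apply/existsP; exists [` uW].
Qed.

(* Walk along the row from u towards u' until leaving W. *)
Lemma row_nbr_lr (T : choiceType) (G : Defs.fgraph T) r x y z (W : {fset T}) u u' :
  hexcoords G r x y z -> W `<=` vertices G -> u \in W ->
  u' \in vertices G `\` W -> y u = y u' -> x u + z u' <= x u' + z u ->
  exists2 n, n \in nbrs G W &
    [/\ y n = y u, x u <= x n <= x u' & z u' <= z n <= z u].
Proof.
move=> H /fsubsetP WG; have [d] := ubnP (x u' + z u - (x u + z u')).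
elim: d u => // d IH u dlt uW u'GW yuu' le_uu'.
have uG := WG u uW; have /fsetDP[u'G u'W] := u'GW.
have [xu yu zu su] := hex_bound H uG; have [xu' yu' zu' su'] := hex_bound H u'G.
have uu' : ~ [/\ x u = x u' & z u = z u'].
  by case=> e1 e2; move: u'W; rewrite -(hex_inj H uG u'G) ?uW.
have [v vG [yv xv zv lt_v uv]] : exists2 v, v \in vertices G &
    [/\ y v = y u, x u <= x v <= x u', z u' <= z v <= z u,
        x u + z v < x v + z u & x u = x v \/ z u = z v].
  (* Adjacent vertices lie in opposite classes. Keeping y, the walk therefore lowers z by one from
     the class with the larger sum, and raises x by one from the other. *)
  have [s1|s2] := su.
    have [|||| v vG [xv yv zv]] := hex_surj H (x u) (y u) (z u).-1; try lia.
    by exists v => //; split; lia.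
  have [|||| v vG [xv yv zv]] := hex_surj H (x u).+1 (y u) (z u); try lia.
  by exists v => //; split; lia.
have [vW|vW] := boolP (v \in W).
  have [|||n nN [yn xn zn]] := IH v _ vW u'GW; try lia.
  by exists n => //; split; lia.
exists v; last by split; lia.
apply/nbrsP; split=> //; exists u => //; apply: (hex_adj H) => //.
  by apply: contraNneq vW => ->.
by case: uv => e; [constructor 1|constructor 2]; lia.
Qed.

(** If [u'] lies on the other side of [u], exchanging x and z reverses the walk. The lower bound on
    [x n] later tells apart neighbours found in different families. *)
Lemma row_nbr (T : choiceType) (G : Defs.fgraph T) r x y z (W : {fset T}) u u' :
  hexcoords G r x y z -> W `<=` vertices G -> u \in W ->
  u' \in vertices G `\` W -> y u = y u' ->
  exists2 n, n \in nbrs G W & y n = y u /\ minn (x u) (x u') <= x n.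
Proof.
move=> H WG uW u'GW yuu'; have [le|/ltnW le] := leqP (x u + z u') (x u' + z u).
  by have [n nN [? ? ?]] := row_nbr_lr H WG uW u'GW yuu' le; exists n => //; split; lia.
have H' : hexcoords G r z y x by apply/hexcoords_swap/hexcoords_rot.
have [|n nN [? ? ?]] := row_nbr_lr H' WG uW u'GW yuu'; first lia.
by exists n => //; split; lia.
Qed.

(** Taking for [S] the set W or its complement gives the full and the empty rows. *)
Definition contains_row (T : choiceType) (G : Defs.fgraph T) r (x : T -> nat) (S : {fset T}) :=
  exists2 i, i < 2 * r & {in vertices G, forall v, x v = i -> v \in S}.

Lemma no_full_row_nbr (T : choiceType) (G : Defs.fgraph T) r x y z (W : {fset T}) :
  hexcoords G r x y z -> W `<=` vertices G -> ~ contains_row G r y W ->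
  {in W, forall v, exists2 n, n \in nbrs G W & y n = y v}.
Proof.
move=> H WG nofull v vW; have vG := fsubsetP WG v vW; have [_ yv _ _] := hex_bound H vG.
apply: contrapT => nonbr; apply: nofull; exists (y v) => // u uG yu.
apply: contrapT => /negP uW; apply: nonbr.
have [|//|n nN []] := row_nbr H WG vW (u' := u); rewrite ?yu ?inE ?uW //.
by exists n.
Qed.

Lemma no_empty_row_nbr (T : choiceType) (G : Defs.fgraph T) r x y z (W : {fset T}) :
  hexcoords G r x y z -> W `<=` vertices G -> ~ contains_row G r y (vertices G `\` W) ->
  {in vertices G `\` W, forall v, exists2 n, n \in nbrs G W & y n = y v}.
Proof.
move=> H WG noempty v vGW; have /fsetDP[vG vW] := vGW; have [_ yv _ _] := hex_bound H vG.
apply: contrapT => nonbr; apply: noempty; exists (y v) => // u uG yu.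
rewrite inE uG andbT; apply/negP => uW; apply: nonbr.
by have [n nN [yn _]] := row_nbr H WG uW vGW yu; exists n; rewrite ?yn.
Qed.

(** * Bounding a set by its projections to rows *)

(** On each class of the bipartition x + y + z is constant, so [card_sum_in_leq] applies; peeling
    about M / 2 times bounds each class by roughly 3/4 M^2. *)
Lemma card_three_projections (T : choiceType) (G : Defs.fgraph T) r x y z (S : {fset T})
    (X Y Z : seq nat) M :
  hexcoords G r x y z -> S `<=` vertices G ->
  {in S, forall v, x v \in X} -> {in S, forall v, y v \in Y} -> {in S, forall v, z v \in Z} ->
  size X = M -> size Y = M -> size Z = M -> 10 * #|` S| <= 19 * M ^ 2.
Proof.
move=> H /fsubsetP SG SX SY SZ sX sY sZ.
(* For M = 1 the bound by classes only gives 2 points, too many for 19/10; but equal coordinates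
   leave a single point. *)
have [M1|M1] := leqP M 1.
  have [->|/fset0Pn[v vS]] := eqVneq S fset0; first by rewrite cardfs0.
  have M_1 : M = 1 by move: (SX v vS) M1; rewrite -sX; case: (X) => [|? []].
  suff : #|` S| <= #|` [fset v]| by rewrite cardfs1; lia.
  apply/fsubset_leq_card/fsubsetP => u uS; rewrite inE; apply/eqP.
  have eq1 (s : seq nat) a b : size s = M -> a \in s -> b \in s -> a = b.
    by rewrite M_1; case: s => [|c []] // _; rewrite !inE => /eqP-> /eqP->.
  apply: (hex_inj H); rewrite ?SG //.
  - exact: eq1 sX (SX u uS) (SX v vS).
  - exact: eq1 sY (SY u uS) (SY v vS).
  - exact: eq1 sZ (SZ u uS) (SZ v vS).
pose P v := (x v + y v + z v).+1 == 3 * r.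
pose S1 := [fset v in S | P v]; pose S2 := [fset v in S | ~~ P v].
have cardS : #|` S| <= #|` S1| + #|` S2|.
  rewrite -cardfsUI; apply: leq_trans (leq_addr _ _); apply: fsubset_leq_card.
  by apply/fsubsetP => v vS; rewrite !inE vS /=; case: (P v).
have cardSi (Si : {fset T}) s : Si `<=` S -> {in Si, forall v, x v + y v + z v = s} ->
    #|` Si| <= M./2 * M + (M - M./2) * (M - M./2).
  move=> /fsubsetP SiS sumSi.
  rewrite -{2}sZ -{2}sX -{3}sY; apply: (@card_sum_in_leq _ s x y z) => [//||v vS|v vS|v vS].
  - move=> u v uS vS xuv yuv; apply: (hex_inj H) => //; try by apply: SG; apply: SiS.
    by move: (sumSi u uS) (sumSi v vS); lia.
  - exact/SX/SiS.
  - exact/SY/SiS.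
  - exact/SZ/SiS.
have cardS1 : #|` S1| <= M./2 * M + (M - M./2) * (M - M./2).
  apply: (cardSi _ (3 * r).-1) => [|v]; first by apply/fsubsetP => v; rewrite inE => /andP[].
  by rewrite !inE /P => /andP[_]; lia.
have cardS2 : #|` S2| <= M./2 * M + (M - M./2) * (M - M./2).
  apply: (cardSi _ (3 * r).-2) => [|v]; first by apply/fsubsetP => v; rewrite inE => /andP[].
  by rewrite !inE /P => /andP[/SG/(hex_bound H)[_ _ _]]; lia.
have := odd_double_half M; set t := M./2 in cardS1 cardS2 *.
case: (odd M) => /= eM; subst M; nia.
Qed.

(** A row inside [S] forces large y and z projections, whose product then has a corner outside the
    grid. The number [w] stands for |W|, as [S] may also be the complement of W. *)
Lemma card_clipped_projections (T : choiceType) (G : Defs.fgraph T) r x y z (S : {fset T})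
    (Y Z : seq nat) M w :
  hexcoords G r x y z -> S `<=` vertices G -> contains_row G r x S ->
  {in S, forall v, y v \in Y} -> {in S, forall v, z v \in Z} ->
  size Y = M -> size Z = M ->
  w <= #|` S| -> w <= 4 * r ^ 2 -> 10 * w <= 19 * M ^ 2.
Proof.
move=> H0 SG [i0 i0lt row0] SY0 SZ0 sY sZ wS wr.
(* The half turn brings the row into the half x >= r, where it crosses all rows y = j and z = k with
   j, k <= r. *)
wlog : x y z Y Z i0 H0 i0lt row0 SY0 SZ0 sY sZ / r <= i0.
  move=> IH; have [ri|ir] := leqP r i0; first exact: (IH x y z Y Z i0).
  pose o i := 2 * r - i.+1.
  apply: (IH _ _ _ (map o Y) (map o Z) (o i0) (hexcoords_opp H0)); rewrite ?size_map //.
  - by rewrite /o; lia.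
  - by move=> v vG e; apply: row0 => //; move: e; have [] := hex_bound H0 vG; rewrite /o; lia.
  - by move=> v vS; apply: map_f; apply: SY0.
  - by move=> v vS; apply: map_f; apply: SZ0.
  - by rewrite /o; lia.
move=> ri.
have SG' := fsubsetP SG.
have inY j : j <= r -> j \in Y.
  move=> jr; have [||||v vG [xv <- _]] := hex_surj H0 i0 j (3 * r - (i0 + j).+1); try lia.
  exact/SY0/row0.
have inZ k : k <= r -> k \in Z.
  move=> kr; have [||||v vG [xv _ <-]] := hex_surj H0 i0 (3 * r - (i0 + k).+1) k; try lia.
  exact/SZ0/row0.
have rM : r < M.
  rewrite -sY -[r.+1](size_iota 0); apply: uniq_leq_size; first exact: iota_uniq.
  by move=> j; rewrite mem_iota => jr; apply: inY; lia.
pose q := r./2.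
pose pr (s t : seq nat) := [seq (p, b) | p <- [seq (j, k) | j <- s, k <- t], b <- [:: true; false]].
(* The projections contain [0, r], but y, z < r./2 would force x >= 2 * r. *)
have cardSM : #|` S| + q * q * 2 <= M * M * 2.
  suff : #|` S| + size (pr (iota 0 q) (iota 0 q)) <= size (pr Y Z).
    by rewrite !size_allpairs !size_iota sY sZ.
  (* The boolean records the class, which together with y and z determines x. *)
  pose f v := ((y v, z v), (x v + y v + z v).+1 == 3 * r).
  apply: (@card_inj_disjoint_leq _ _ f).
  - move=> u v uS vS [yuv zuv]; have uG := SG' u uS; have vG := SG' v vS.
    have [_ _ _ su] := hex_bound H0 uG; have [_ _ _ sv] := hex_bound H0 vG.
    by move=> e; apply: (hex_inj H0) => //; lia.
  - move=> v vS; apply/allpairsP; exists (f v); split => //; last by rewrite !inE; case: (f v).2.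
    by apply/allpairsP; exists (y v, z v); rewrite SY0 ?SZ0.
  - by apply: allpairs_uniq => //; [apply: allpairs_uniq; rewrite ?iota_uniq // => -[? ?] []|
      move=> [? ?] []].
  - move=> _ /allpairsP[[p b] /= [/allpairsP[[j k] /= [jq kq ->]] bb ->]].
    move: jq kq; rewrite !mem_iota /q => jq kq.
    apply/allpairsP; exists ((j, k), b); split => //=.
    by apply/allpairsP; exists (j, k); split => //=; [apply: inY|apply: inZ]; lia.
  - move=> v vS; apply/negP => /allpairsP[[p b] /= [/allpairsP[[j k] /= [jq kq ->]] bb]] [yv zv _].
    move: jq kq; rewrite !mem_iota /q => jq kq.
    by have [] := hex_bound H0 (SG' v vS); lia.
have rq : r <= 2 * q + 1 by rewrite /q; lia.
have [r1|r1] := leqP r 1; first nia.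
have q1 : 0 < q by rewrite /q; lia.
(* If the bound failed, |S| <= 2 M^2 - 2 q^2 would give 20 q^2 < M^2, while w <= 4 r^2 and r <= 3 q
   give 19 M^2 < 360 q^2. *)
rewrite leqNgt; apply/negP => lt1.
have : 20 * (q * q) < M ^ 2 by nia.
have : 19 * M ^ 2 < 40 * r ^ 2 by lia.
have : r <= 3 * q by lia.
nia.
Qed.

(** * The isoperimetric inequality in row coordinates *)

Section Isoperimetry.
Variables (T : choiceType) (G : Defs.fgraph T) (r : nat) (W : {fset T}).
Hypothesis (WG : W `<=` vertices G).

Local Notation N := (nbrs G W).
Local Notation W' := (vertices G `\` W).
Local Notation full x := (contains_row G r x W).
Local Notation empty x := (contains_row G r x W').

Lemma card_projections_nbrs x y z (S : {fset T}) w :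
  hexcoords G r x y z -> S `<=` vertices G ->
  {in S, forall v, exists2 n, n \in N & y n = y v} ->
  {in S, forall v, exists2 n, n \in N & z n = z v} ->
  (~ contains_row G r x S -> {in S, forall v, exists2 n, n \in N & x n = x v}) ->
  w <= #|` S| -> w <= 4 * r ^ 2 -> 10 * w <= 19 * #|` N| ^ 2.
Proof.
move=> H SG Sy Sz Sx wS wr.
have inmap (f : T -> nat) : {in S, forall v, exists2 n, n \in N & f n = f v} ->
    {in S, forall v, f v \in map f N}.
  by move=> Sf v /Sf[n nN <-]; apply: map_f.
have [xrow|/Sx{}Sx] := pselect (contains_row G r x S).
  apply: (card_clipped_projections H SG xrow (inmap _ Sy) (inmap _ Sz)) wS wr;
  exact: size_map.
apply: leq_trans (card_three_projections H SG (inmap _ Sx) (inmap _ Sy) (inmap _ Sz)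
  _ _ _); rewrite ?size_map //; lia.
Qed.

(** A crude count by x, y and the class suffices: half of it is the bound 4 r^2 needed for |W|. *)
Lemma card_hexcoords_leq x y z : hexcoords G r x y z -> #|` vertices G| <= 8 * r ^ 2.
Proof.
move=> H; suff : #|` vertices G| <= size [seq (p, b) |
    p <- [seq (i, j) | i <- iota 0 (2 * r), j <- iota 0 (2 * r)], b <- [:: true; false]].
  by rewrite !size_allpairs !size_iota /=; lia.
pose f v := ((x v, y v), (x v + y v + z v).+1 == 3 * r).
apply: (@card_inj_leq _ _ f) => [u v uG vG [xuv yuv e]|v vG].
  have [_ _ _ su] := hex_bound H uG; have [_ _ _ sv] := hex_bound H vG.
  by apply: (hex_inj H) => //; lia.
have [xv yv _ _] := hex_bound H vG.
apply/allpairsP; exists (f v); split => //; last by rewrite !inE; case: (f v).2.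
by apply/allpairsP; exists (x v, y v); rewrite !mem_iota.
Qed.

Lemma all_rows_mixed x y z :
  hexcoords G r x y z -> ~ full y -> ~ empty y -> 2 * r <= #|` N|.
Proof.
move=> H nofull noempty; rewrite -[2 * r](size_iota 0).
apply: (@card_surj_geq _ _ y); first exact: iota_uniq.
move=> j; rewrite mem_iota => /= jr.
(* Any vertex of row j would do; this one has the largest x compatible with x + y + z = 3 r - 1. *)
have [v vG [_ yv _]] : exists2 v, v \in vertices G &
    [/\ x v = minn (2 * r).-1 (3 * r - j.+1), y v = j &
        z v = 3 * r - j.+1 - minn (2 * r).-1 (3 * r - j.+1)].
  by apply: hex_surj H _ _ _ _ _ _ _; lia.
have [vW|vW] := boolP (v \in W).
  by have [n nN yn] := no_full_row_nbr H WG nofull vW; exists n; rewrite // yn.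
have vW' : v \in W' by rewrite inE vW.
have [n nN yn] := no_empty_row_nbr H WG noempty vW'.
by exists n; rewrite // yn.
Qed.

(* A full row never meets an empty one, so all four rows lie on the same side of
   the centre, say the upper half.  Each row y = j with j < r crosses both rows of
   the x-family, and each row x = i with i < r crosses the two other rows; the
   resulting neighbours satisfy x >= r and x < r respectively. *)
Lemma full_empty_rows x y z : 0 < r -> hexcoords G r x y z ->
  full x -> empty x -> full y -> empty z -> 2 * r <= #|` N|.
Proof.
move=> r0 H0 [a0 a0lt Fa0] [a0' a0'lt Ea0] [b0 b0lt Fb0] [c0 c0lt Ec0].
wlog : x y z a0 a0' b0 c0 H0 a0lt Fa0 a0'lt Ea0 b0lt Fb0 c0lt Ec0 / r <= c0.
  move=> IH; have [rc|cr] := leqP r c0; first exact: (IH x y z a0 a0' b0 c0).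
  pose o i := 2 * r - i.+1.
  have oK (S : {fset T}) (f : T -> nat) i : {in vertices G, forall v, f v < 2 * r} ->
    i < 2 * r -> {in vertices G, forall v, f v = i -> v \in S} ->
    {in vertices G, forall v, o (f v) = o i -> v \in S}.
    by move=> flt ilt Sf v vG e; apply: Sf => //; move: (flt v vG) e; rewrite /o; lia.
  have b_x : {in vertices G, forall v, x v < 2 * r} by move=> v /(hex_bound H0)[].
  have b_y : {in vertices G, forall v, y v < 2 * r} by move=> v /(hex_bound H0)[].
  have b_z : {in vertices G, forall v, z v < 2 * r} by move=> v /(hex_bound H0)[].
  by apply: (IH _ _ _ (o a0) (o a0') (o b0) (o c0) (hexcoords_opp H0));
    [rewrite /o; lia|exact: oK|rewrite /o; lia|exact: oK|rewrite /o; lia|exact: oK|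
     rewrite /o; lia|exact: oK|rewrite /o; lia].
move=> rc.
have noncross v : v \in W -> v \in W' -> False by rewrite inE => -> .
(* Rows of two families with index sum below 3 r cross as soon as one index is at least r. Starting
   from c0 >= r, this places a0, b0 and then a0' above r. *)
have ac : 3 * r <= a0 + c0.
  rewrite leqNgt; apply/negP => lt.
  have [||||v vG [xv yv zv]] := hex_surj H0 a0 (minn (2 * r).-1 (3 * r - (a0 + c0).+1)) c0;
    try lia.
  exact: noncross (Fa0 v vG xv) (Ec0 v vG zv).
have bc : 3 * r <= b0 + c0.
  rewrite leqNgt; apply/negP => lt.
  have [||||v vG [xv yv zv]] := hex_surj H0 (minn (2 * r).-1 (3 * r - (b0 + c0).+1)) b0 c0;
    try lia.
  exact: noncross (Fb0 v vG yv) (Ec0 v vG zv).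
have ab : 3 * r <= a0' + b0.
  rewrite leqNgt; apply/negP => lt.
  have [||||v vG [xv yv zv]] := hex_surj H0 a0' b0 (minn (2 * r).-1 (3 * r - (a0' + b0).+1));
    try lia.
  exact: noncross (Fb0 v vG yv) (Ea0 v vG xv).
pose P v := r <= x v.
pose N1 := [fset v in N | P v]; pose N2 := [fset v in N | ~~ P v].
have cardN : #|` N1| + #|` N2| <= #|` N|.
  rewrite -cardfsUI [N1 `&` N2](_ : _ = fset0) ?cardfs0 ?addn0.
    by apply/fsubset_leq_card/fsubsetP => v; rewrite !inE => /orP[]/andP[].
  by apply/fsetP => v; rewrite !inE; case: (P v); rewrite ?andbF.
suff [N1r N2r] : r <= #|` N1| /\ r <= #|` N2| by lia.
split; rewrite -{1}(size_iota 0 r).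
  apply: (@card_surj_geq _ _ y); first exact: iota_uniq.
  move=> j; rewrite mem_iota => /= jr.
  have [||||u uG [xu yu zu]] := hex_surj H0 a0 j (3 * r - (a0 + j).+1); try lia.
  have [||||u' u'G [xu' yu' zu']] := hex_surj H0 a0' j (3 * r - (a0' + j).+1); try lia.
  have [|n nN [yn xn]] := row_nbr H0 WG (Fa0 u uG xu) (Ea0 u' u'G xu'); first by rewrite yu.
  exists n; last by rewrite yn.
  by rewrite inE /= inE /= nN /P; lia.
have H1 : hexcoords G r y x z by apply: hexcoords_swap.
apply: (@card_surj_geq _ _ x); first exact: iota_uniq.
move=> i; rewrite mem_iota => /= ir.
have [||||u uG [xu yu zu]] := hex_surj H0 i b0 (3 * r - (i + b0).+1); try lia.
have [||||u' u'G [xu' yu' zu']] := hex_surj H0 i (3 * r - (i + c0).+1) c0; try lia.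
have [|n nN [xn _]] := row_nbr H1 WG (Fb0 u uG yu) (Ec0 u' u'G zu'); first by rewrite xu.
exists n; last by rewrite xn.
by rewrite inE /= inE /= nN /P; lia.
Qed.

Lemma hex_isoperimetry x y z : 0 < r -> hexcoords G r x y z ->
  2 * #|` W| <= #|` vertices G| -> 10 * #|` W| <= 19 * #|` N| ^ 2.
Proof.
move=> r0 H half.
have wr : #|` W| <= 4 * r ^ 2 by have := card_hexcoords_leq H; lia.
have ww' : #|` W| <= #|` W'|.
  by rewrite cardfsDS //; lia.
have W'G : W' `<=` vertices G by apply: fsubsetDl.
have big : 2 * r <= #|` N| -> 10 * #|` W| <= 19 * #|` N| ^ 2 by nia.
have H1 := hexcoords_rot H; have H2 := hexcoords_rot H1.
have A a b c : hexcoords G r a b c -> ~ full b -> ~ full c -> 10 * #|` W| <= 19 * #|` N| ^ 2.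
  move=> Ha Fb Fc; have Hb := hexcoords_rot Ha; have Hc := hexcoords_rot Hb.
  apply: (card_projections_nbrs Ha WG) => // [||Fa].
  - exact: no_full_row_nbr Ha WG Fb.
  - exact: no_full_row_nbr Hb WG Fc.
  - exact: no_full_row_nbr Hc WG Fa.
(* The complement is bounded instead of W, which is enough since |W| <= |W'|. *)
have B a b c : hexcoords G r a b c -> ~ empty b -> ~ empty c -> 10 * #|` W| <= 19 * #|` N| ^ 2.
  move=> Ha Fb Fc; have Hb := hexcoords_rot Ha; have Hc := hexcoords_rot Hb.
  apply: (card_projections_nbrs Ha W'G) => // [||Fa].
  - exact: no_empty_row_nbr Ha WG Fb.
  - exact: no_empty_row_nbr Hb WG Fc.
  - exact: no_empty_row_nbr Hc WG Fa.
have C a b c : hexcoords G r a b c -> ~ full b -> ~ empty b -> 10 * #|` W| <= 19 * #|` N| ^ 2.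
  by move=> Ha Fb Eb; apply/big/(all_rows_mixed Ha).
have D a b c : hexcoords G r a b c -> full a -> empty a -> full b -> empty c ->
    10 * #|` W| <= 19 * #|` N| ^ 2.
  by move=> Ha *; apply/big/(full_empty_rows r0 Ha).
(* In [D] the three families play distinct roles, so all six orders are needed. *)
have K := hexcoords_swap H; have K1 := hexcoords_rot K; have K2 := hexcoords_rot K1.
move: (A _ _ _ H) (A _ _ _ H1) (A _ _ _ H2) (B _ _ _ H) (B _ _ _ H1) (B _ _ _ H2)
  (C _ _ _ H) (C _ _ _ H1) (C _ _ _ H2) (D _ _ _ H) (D _ _ _ H1) (D _ _ _ H2)
  (D _ _ _ K) (D _ _ _ K1) (D _ _ _ K2).
(* If [A] and [B] fail, at least two families have a full row and at least two an empty one; if [C]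
   fails too, every family has one or the other, and some order of the families fits [D]. *)
clear; case: (EM (full x)); case: (EM (full y)); case: (EM (full z));
case: (EM (empty x)); case: (EM (empty y)); case: (EM (empty z)); tauto.
Qed.
End Isoperimetry.

Import Order.TTheory GRing.Theory Num.Theory.
Local Open Scope ring_scope.

(** * The grid of radius r *)

(** Adjacency in the triangular lattice, as linear inequalities that [lia] can decide. It serves
    both between a centre and its corners and between the ends of an edge. *)
Definition near (c v : point) : bool :=
  [&& (-1 <= v.1 - c.1 <= 1), (-1 <= v.2 - c.2 <= 1),
      (-1 <= (v.1 - c.1) + (v.2 - c.2) <= 1) & (v.1 != c.1) || (v.2 != c.2)].

(* The three linear forms vanish on the lines through the origin parallel to the
   zigzags; on a hexagon centre they are multiples of 3. *)
Definition within (m : nat) (v : point) : bool :=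
  [&& - m%:Z <= v.2 - v.1 <= m%:Z, - m%:Z <= v.1 *+ 2 + v.2 <= m%:Z &
      - m%:Z <= v.1 + v.2 *+ 2 <= m%:Z].

Lemma near_corner c v : near c v -> exists k, v = corner c k.
Proof.
case: c v => [a b] [a' b']; rewrite /near /= => H.
have : [|| (a' == a + 1) && (b' == b), (a' == a) && (b' == b + 1),
           (a' == a - 1) && (b' == b + 1), (a' == a - 1) && (b' == b),
           (a' == a) && (b' == b - 1) | (a' == a + 1) && (b' == b - 1)] by lia.
case/or4P; [| | |case/or3P]; case/andP=> /eqP-> /eqP->.
- by exists (@Ordinal 6 0 isT); rewrite /corner /dir /= addr0.
- by exists (@Ordinal 6 1 isT); rewrite /corner /dir /= addr0.
- by exists (@Ordinal 6 2 isT).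
- by exists (@Ordinal 6 3 isT); rewrite /corner /dir /= addr0.
- by exists (@Ordinal 6 4 isT); rewrite /corner /dir /= addr0.
- by exists (@Ordinal 6 5 isT).
Qed.

Lemma corner_near c k : near c (corner c k).
Proof.
case: c k => [a b] [[|[|[|[|[|[|k]]]]]] ilt]; rewrite /near /corner /dir //=; lia.
Qed.

Lemma in_vertices_hexagon c v : (v \in vertices (hexagon c)) = near c v.
Proof.
apply/imfsetP/idP => /= [[k _ ->]|/near_corner[k ->]]; first exact: corner_near.
by exists k.
Qed.

Lemma in_edges_hexagon c u v : near c u -> near c v -> near u v ->
  [fset u; v] \in edges (hexagon c).
Proof.
move=> /near_corner[k ->] /near_corner[l ->] kl; apply/imfsetP => /=.
have : (l == ordS k) || (k == ordS l).
  move: kl; case: c k l => [a b] [[|[|[|[|[|[|k]]]]]] klt] [[|[|[|[|[|[|l]]]]]] llt] //;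
  rewrite /near /corner /dir /= -!val_eqE //=; lia.
by case/orP => /eqP->; [exists k|exists l; rewrite // fsetUC].
Qed.

Lemma in_layer G c :
  reflect (is_center c /\ exists2 v, v \in vertices G & near c v) (c \in layer G).
Proof.
have nearE v : near c v <-> c \in [fset (v.1 - (dir k).1, v.2 - (dir k).2) | k in 'I_6].
  split=> [/near_corner[k ->]|/imfsetP[/= k _ ->]].
    by apply/imfsetP; exists k => //=; rewrite !addrK -surjective_pairing.
  have := corner_near (v.1 - (dir k).1, v.2 - (dir k).2) k.
  by rewrite /corner /= !subrK -surjective_pairing.
apply: (iffP (bigfcupP _ _ _ _)) => [[v /andP[vG _]]|[cc [v vG]]].
  by rewrite !inE /= => /andP[/nearE cv cc]; split=> //; exists v.
by move/nearE => cv; exists v; rewrite ?vG // inE /= inE cv.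
Qed.

Lemma is_centerE c : is_center c = (3 %| c.1 - c.2)%Z. Proof. by []. Qed.

(** A unit step changes each form by at most 2, giving 3 m + 4, and divisibility by 3 at a centre
    lowers this to 3 m + 3. *)
Lemma within_center m c v : is_center c -> near c v -> within (3 * m + 2) v ->
  within (3 * m + 3) c.
Proof.
by case: c v => [a b] [a' b']; rewrite is_centerE /near /within /= => *; lia.
Qed.

Lemma near_center c v : is_center c -> near c v -> ~~ is_center v.
Proof. by case: c v => [a b] [a' b']; rewrite !is_centerE /near /= => *; lia. Qed.

Lemma within_corner m c v : is_center c -> near c v -> within (3 * m) c ->
  within (3 * m + 2) v.
Proof.
by case: c v => [a b] [a' b']; rewrite is_centerE /near /within /= => *; lia.
Qed.

Lemma center_near m v : ~~ is_center v -> within (3 * m + 2) v ->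
  exists c, [/\ is_center c, near c v & within (3 * m) c].
Proof.
case: v => [a b]; rewrite is_centerE /= => cv H.
have [e|e] : (3 %| a - b - 1)%Z \/ (3 %| a - b + 1)%Z by lia.
  have : [|| within (3 * m) (a - 1, b), within (3 * m) (a, b + 1) |
             within (3 * m) (a + 1, b - 1)].
    by move: e H; rewrite /within /=; lia.
  by case/or3P => ?; eexists; (split; last eassumption);
    rewrite /is_center /near /=; lia.
have : [|| within (3 * m) (a + 1, b), within (3 * m) (a, b - 1) |
           within (3 * m) (a - 1, b + 1)].
  by move: e H; rewrite /within /=; lia.
by case/or3P => ?; eexists; (split; last eassumption);
  rewrite /is_center /near /=; lia.
Qed.

(** This shows that every hexagon expected in the next layer touches the present grid. *)
Lemma corner_within m c : is_center c -> within (3 * m + 3) c ->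
  exists2 v, near c v & within (3 * m + 2) v.
Proof.
case: c => [a b]; rewrite is_centerE /= => cc H.
have : [|| within (3 * m + 2) (a + 1, b), within (3 * m + 2) (a, b + 1),
           within (3 * m + 2) (a - 1, b + 1), within (3 * m + 2) (a - 1, b),
           within (3 * m + 2) (a, b - 1) | within (3 * m + 2) (a + 1, b - 1)].
  by move: cc H; rewrite /within /=; lia.
by case/or4P => [?|?|?|/or3P[]?]; eexists; try eassumption; rewrite /near /=; lia.
Qed.

Lemma center_near_edge m u v : ~~ is_center u -> ~~ is_center v -> near u v ->
  within (3 * m + 2) u -> within (3 * m + 2) v ->
  exists c, [/\ is_center c, near c u, near c v & within (3 * m) c].
Proof.
case: u v => [a b] [a' b']; rewrite !is_centerE => cu cv uv Hu Hv.
(* The two points forming an equilateral triangle with the edge. *)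
have : within (3 * m) (a + b - b', a' + b' - a) || within (3 * m) (a' + b' - b, b + a - a').
  by move: cu cv uv Hu Hv; rewrite /within /near /=; lia.
by case/orP => ?; eexists; (split; last eassumption);
  move: cu cv uv; rewrite /is_center /near /=; lia.
Qed.

Lemma hexgridS r : hexgrid r.+2 = add_layer (hexgrid r.+1).
Proof. by []. Qed.

(** By induction: the layer consists of the centres within 3 r + 3, and their corners are the
    non-central points within 3 r + 5. *)
Lemma in_vertices_hexgrid r v :
  (v \in vertices (hexgrid r.+1)) = ~~ is_center v && within (3 * r + 2) v.
Proof.
elim: r v => [|r IH] v.
  rewrite /hexgrid in_vertices_hexagon /near /within /= is_centerE.
  case: v => [a b] /=; lia.
rewrite hexgridS; apply/fsetUP/andP => [[|/bigfcupP[c]]|[cv Hv]].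
- by rewrite IH => /andP[-> /=]; rewrite /within; lia.
- rewrite andbT in_vertices_hexagon => /in_layer[cc [u]]; rewrite IH => /andP[_ uG] cu cv.
  split; first exact: near_center cc cv.
  by apply: (within_corner cc cv); have := within_center cc cu uG; rewrite /within; lia.
- right; have [c [cc ccv Hc]] := center_near cv Hv.
  apply/bigfcupP; exists c; last by rewrite in_vertices_hexagon.
  have [|u cu Hu] := @corner_within r c cc; first by move: Hc; rewrite /within; lia.
  rewrite andbT; apply/in_layer; split=> //; exists u; rewrite // IH Hu andbT.
  exact: near_center cc cu.
Qed.

Lemma in_edges_hexgrid r u v : u \in vertices (hexgrid r.+1) ->
  v \in vertices (hexgrid r.+1) -> near u v -> [fset u; v] \in edges (hexgrid r.+1).
Proof.
rewrite !in_vertices_hexgrid => /andP[cu Hu] /andP[cv Hv] uv.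
have [c [cc ccu ccv Hc]] := center_near_edge cu cv uv Hu Hv.
case: r Hu Hv Hc => [|r] Hu Hv Hc.
  have -> : hexgrid 1 = hexagon (0, 0) by [].
  suff <- : c = (0, 0) by apply: in_edges_hexagon.
  by case: c Hc {cc ccu ccv} => a b; rewrite /within /= => *; congr pair; lia.
rewrite hexgridS; apply/fsetUP; right; apply/bigfcupP.
exists c; last exact: in_edges_hexagon.
have [|w cw Hw] := @corner_within r c cc; first by move: Hc; rewrite /within; lia.
rewrite andbT; apply/in_layer; split=> //; exists w; rewrite // in_vertices_hexgrid Hw andbT.
exact: near_center cc cw.
Qed.

(** A form takes values nonzero modulo 3 on vertices, and a zigzag row joins the two values between
    consecutive multiples of 3. The shift by 3 r makes them positive on the grid of radius r. *)
Definition row_index (r : nat) (a : int) : nat := (absz (a + (3 * r)%:Z)%R %/ 3)%N.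

Lemma row_indexE r (a e : int) (i : nat) : e = 1 \/ e = 2 ->
  a + (3 * r)%:Z = (3 * i)%:Z + e -> row_index r a = i.
Proof. by rewrite /row_index => *; lia. Qed.

Lemma row_indexP r (a e : int) : e = 1 \/ e = 2 -> (3 %| a - e)%Z -> - (3 * r)%:Z <= a ->
  a + (3 * r)%:Z = (3 * row_index r a)%:Z + e.
Proof. by rewrite /row_index => *; lia. Qed.

(** The three forms are congruent modulo 3, hence the common [e]. With the sign chosen for the third
    they add up to 0, so the three indices sum to 3 (r + 1) - e. *)
Lemma hexgrid_rows r (v : point) : v \in vertices (hexgrid r.+1) ->
  exists2 e : int, e = 1 \/ e = 2 &
  [/\ v.2 - v.1 + (3 * r.+1)%:Z = (3 * row_index r.+1 (v.2 - v.1))%:Z + e,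
      v.1 *+ 2 + v.2 + (3 * r.+1)%:Z = (3 * row_index r.+1 (v.1 *+ 2 + v.2))%:Z + e &
      - (v.1 + v.2 *+ 2) + (3 * r.+1)%:Z =
        (3 * row_index r.+1 (- (v.1 + v.2 *+ 2)))%:Z + e].
Proof.
case: v => a b; rewrite in_vertices_hexgrid /is_center /within /= => H.
have [e e12 e3] : exists2 e : int, e = 1 \/ e = 2 & (3 %| b - a - e)%Z.
  have [?|?] : (3 %| b - a - 1)%Z \/ (3 %| b - a - 2)%Z by lia.
    by exists 1; [left|].
  by exists 2; [right|].
by exists e => //; split; apply: row_indexP => //; lia.
Qed.

Lemma hexgrid_hexcoords r : (0 < r)%N ->
  hexcoords (hexgrid r) r (fun v => row_index r (v.2 - v.1))
    (fun v => row_index r (v.1 *+ 2 + v.2)) (fun v => row_index r (- (v.1 + v.2 *+ 2))).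
Proof.
case: r => // r _; split.
- move=> v vG; have [e e12 []] := hexgrid_rows vG.
  move: vG; rewrite in_vertices_hexgrid /within => /andP[_].
  case: v => a b /=.
  by do 3!move: (row_index _ _); move=> *; split; lia.
- move=> i j k ilt jlt klt s.
  have [e e12 es] : exists2 e : int, e = 1 \/ e = 2 & (i + j + k)%:Z + e = (3 * r.+1)%:Z.
    by case: s => s; [exists 1; [left|lia]|exists 2; [right|lia]].
  (* The point (a, b) solving b - a = 3 i + e - 3 (r + 1) and 2 a + b = 3 j + e - 3 (r + 1). *)
  exists (j%:Z - i%:Z, (2 * i + j)%:Z - (3 * r.+1)%:Z + e).
    by rewrite in_vertices_hexgrid /is_center /within /=; lia.
  by rewrite /=; split; apply: (row_indexE e12); lia.
- move=> u v uG vG; have [e e12 []] := hexgrid_rows uG; have [e' e12' []] := hexgrid_rows vG.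
  case: u v {uG vG} => a b [a' b'] /=; do 6!move: (row_index _ _).
  by move=> *; congr pair; lia.
- move=> u v uG vG neq H; apply: in_edges_hexgrid => //.
  have [e e12 []] := hexgrid_rows uG; have [e' e12' []] := hexgrid_rows vG.
  case: u v neq H {uG vG} => a b [a' b'] neq H.
  have {neq} : (a != a') || (b != b') by rewrite -negb_and.
  rewrite /near /=; move: H => /=; do 6!move: (row_index _ _).
  by move=> ? ? ? ? ? ? [] [] *; lia.
Qed.

(** * The isoperimetric inequalities *)

Lemma card_nbrs_out_edges (T : choiceType) (G : Defs.fgraph T) (W : {fset T}) :
  (#|` nbrs G W| <= #|` out_edges G W|)%N.
Proof.
rewrite -(size_map (fun n => [fset n])).
(* Removing [W] from an outgoing edge leaves its outer end, so every neighbour arises from some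
   outgoing edge. *)
apply: (@card_surj_geq _ _ (fun e => e `\` W)).
  by rewrite map_inj_uniq ?fset_uniq //; apply: fset1_inj.
move=> _ /mapP[n /nbrsP[nG nW [u uW nu]] ->]; exists [fset n; u].
  have nGW : n \in vertices G `\` W by rewrite inE nW.
  rewrite inE /= inE nu; apply/existsP; exists [` uW]; apply/existsP; exists [` nGW].
  by rewrite fsetUC.
apply/fsetP => v; rewrite !inE; have [->|] := eqVneq v n; first by rewrite nW.
by have [->|] := eqVneq v u; rewrite ?uW ?andbF.
Qed.

(** A neighbour outside [W] would put the interior vertex [u] into the boundary. *)
Lemma nbrs_interior (T : choiceType) (G : Defs.fgraph T) (W : {fset T}) :
  W `<=` vertices G -> nbrs G (W `\` bdry G W) `<=` bdry G W.
Proof.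
move=> /fsubsetP WG; apply/fsubsetP => n /nbrsP[nG nWB [u /fsetDP[uW uB] nu]].
have [nW|nW] := boolP (n \in W); first by move: nWB; rewrite in_fsetD nW andbT negbK.
have nGW : n \in vertices G `\` W by rewrite in_fsetD nW.
case/negP: uB; rewrite inE /= inE uW; apply/existsP; exists [` nGW].
by rewrite fsetUC.
Qed.

Lemma hexgrid_nbrs r (W : {fset point}) : (0 < r)%N -> W `<=` vertices (hexgrid r) ->
  (2 * #|` W| <= #|` vertices (hexgrid r)|)%N ->
  (10 * #|` W| <= 19 * #|` nbrs (hexgrid r) W| ^ 2)%N.
Proof. by move=> r0 WG; apply: (hex_isoperimetry WG r0 (hexgrid_hexcoords r0)). Qed.

Lemma hexgrid_bdry r (W : {fset point}) : (0 < r)%N -> W `<=` vertices (hexgrid r) ->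
  (2 * #|` W| <= #|` vertices (hexgrid r)|)%N ->
  (10 * #|` W| <= 19 * #|` bdry (hexgrid r) W| ^ 2 + 10 * #|` bdry (hexgrid r) W|)%N.
Proof.
move=> r0 WG half; set B := bdry _ _.
have BW : B `<=` W by apply/fsubsetP => v; rewrite inE => /andP[].
have cardWB := cardfsDS BW.
have NB : (#|` nbrs (hexgrid r) (W `\` B)| <= #|` B|)%N.
  exact/fsubset_leq_card/nbrs_interior.
have half' : (2 * #|` W `\` B| <= #|` vertices (hexgrid r)|)%N.
  by apply: leq_trans half; rewrite leq_mul2l /=; apply/fsubset_leq_card/fsubsetDl.
have := hexgrid_nbrs r0 (fsubset_trans (fsubsetDl W B) WG) half'.
have : (#|` nbrs (hexgrid r) (W `\` B)| ^ 2 <= #|` B| ^ 2)%N by rewrite leq_sqr.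
rewrite cardWB mulnBr => N2 WB; rewrite addnC -leq_subLR; apply: leq_trans WB _.
by rewrite leq_mul2l.
Qed.

(** * From the integer inequalities to the real constants *)

Section RealBounds.
Variables (R : realType).

Lemma sqrt_card_bound (c : R) (w m : nat) : c ^+ 2 <= 10%:R / 19%:R ->
  (10 * w <= 19 * m ^ 2)%N -> c * Num.sqrt w%:R <= m%:R.
Proof.
move=> c2; rewrite -mulnn -(ler_nat R) !natrM => wm.
have [c0|/ltW c0] := leP c 0.
  by apply: le_trans (_ : 0 <= _) => //; apply: mulr_le0_ge0 => //; apply: sqrtr_ge0.
rewrite -(ler_pXn2r (n := 2)) ?nnegrE ?mulr_ge0 ?sqrtr_ge0 // exprMn sqr_sqrtr //.
by have w0 : 0 <= w%:R :> R by []; nra.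
Qed.

Lemma sqrt_card_bdry_bound (c : R) (w b : nat) : c ^+ 2 <= 10%:R / 19%:R ->
  (10 * w <= 19 * b ^ 2 + 10 * b)%N ->
  c * Num.sqrt (w%:R + c ^+ 2 / 4%:R) - c ^+ 2 / 2%:R <= b%:R.
Proof.
move=> c2; rewrite -mulnn -(ler_nat R) natrD !natrM => wb.
have c20 := sqr_ge0 c; have b0 : 0 <= b%:R :> R by [].
have w0 : 0 <= w%:R :> R by [].
rewrite lerBlDr.
have [c0|/ltW c0] := leP c 0.
  apply: le_trans (_ : 0 <= _); last by lra.
  by apply: mulr_le0_ge0 => //; apply: sqrtr_ge0.
rewrite -(ler_pXn2r (n := 2)) ?nnegrE ?mulr_ge0 ?sqrtr_ge0 //; last by lra.
rewrite exprMn sqr_sqrtr; last by lra.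
(* The squared inequality reduces to c^2 (w - b) <= b^2, trivial for w <= b and otherwise a
   consequence of c^2 <= 10/19. *)
have [wb'|wb'] := leP (w%:R : R) b%:R; first by nra.
nra.
Qed.

Lemma sqrt6B3_sqr : (Num.sqrt 6%:R - Num.sqrt 3%:R : R) ^+ 2 <= 10%:R / 19%:R.
Proof.
have s6 : Num.sqrt 6%:R ^+ 2 = 6%:R :> R by rewrite sqr_sqrtr.
have s3 : Num.sqrt 3%:R ^+ 2 = 3%:R :> R by rewrite sqr_sqrtr.
have p6 := sqrtr_ge0 (6%:R : R); have p3 := sqrtr_ge0 (3%:R : R).
move: (Num.sqrt 6%:R : R) (Num.sqrt 3%:R : R) s6 s3 p6 p3 => a b a2 b2 a0 b0.
(* Since (a - b)^2 = 9 - 2 a b, the goal amounts to a b >= (9 - 10/19) / 2 = 161/38; here a b is the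
   square root of 18. *)
have ab : 161%:R / 38%:R <= a * b.
  rewrite -(ler_pXn2r (n := 2)) ?nnegrE ?mulr_ge0 //; last by lra.
  by rewrite [leRHS]exprMn a2 b2; lra.
by rewrite sqrrB a2 b2; lra.
Qed.

Lemma ltr_sqrt6B3_sqr (c : R) : 0 <= c -> c < Num.sqrt 6%:R - Num.sqrt 3%:R ->
  c ^+ 2 <= 10%:R / 19%:R.
Proof.
move=> c0 lt; apply: le_trans sqrt6B3_sqr.
by rewrite ler_pXn2r ?nnegrE // ?(ltW lt) // (le_trans c0) // ltW.
Qed.
End RealBounds.

Theorem theorem2 (R : realType) :
  (forall r : nat, (1 <= r)%N ->
     forall W : {fset point}, W `<=` vertices (hexgrid r) ->
     (2 * #|` W| <= #|` vertices (hexgrid r)|)%N ->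
     [/\ (let c : R := 6053%:R / 10000%:R in
          #|` nbrs (hexgrid r) W|%:R >= c * Num.sqrt #|` W|%:R),
         (let c : R := Num.sqrt 6%:R - Num.sqrt 3%:R in
          #|` out_edges (hexgrid r) W|%:R >= c * Num.sqrt #|` W|%:R)
       & (let c : R := 6053%:R / 10000%:R in
          #|` bdry (hexgrid r) W|%:R >=
            c * Num.sqrt (#|` W|%:R + c ^+ 2 / 4%:R) - c ^+ 2 / 2%:R)])
  /\
  (forall c : R, c < Num.sqrt 6%:R - Num.sqrt 3%:R ->
     exists Rc : nat, forall r : nat, (1 <= r)%N -> (Rc <= r)%N ->
     forall W : {fset point}, W `<=` vertices (hexgrid r) ->
     (2 * #|` W| <= #|` vertices (hexgrid r)|)%N ->
     #|` nbrs (hexgrid r) W|%:R >= c * Num.sqrt #|` W|%:R /\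
     #|` bdry (hexgrid r) W|%:R >=
       c * Num.sqrt (#|` W|%:R + c ^+ 2 / 4%:R) - c ^+ 2 / 2%:R).
Proof.
have c1 : (6053%:R / 10000%:R : R) ^+ 2 <= 10%:R / 19%:R by lra.
split=> [r r0 W WG half|c clt].
  have N := hexgrid_nbrs r0 WG half; have B := hexgrid_bdry r0 WG half.
  split; [exact: sqrt_card_bound|apply: sqrt_card_bound (sqrt6B3_sqr R) _|
          exact: sqrt_card_bdry_bound].
  by apply: leq_trans N _; rewrite leq_mul2l leq_sqr card_nbrs_out_edges.
(* The inequality is uniform in r and its constant 10/19 already exceeds the square of the limiting
   value of c. *)
exists 0%N => r r0 _ W WG half.
have N := hexgrid_nbrs r0 WG half; have B := hexgrid_bdry r0 WG half.
have [c0|c0] := leP 0 c.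
  have c2 := ltr_sqrt6B3_sqr c0 clt.
  by split; [exact: sqrt_card_bound|exact: sqrt_card_bdry_bound].
(* For negative c the square may exceed 10/19, but both right-hand sides are then nonpositive. *)
have c20 := sqr_ge0 c.
split; first apply: le_trans (_ : 0 <= _) => //.
  by apply: mulr_le0_ge0; [exact: ltW|exact: sqrtr_ge0].
apply: le_trans (_ : 0 <= _) => //; rewrite subr_le0; apply: le_trans (_ : 0 <= _); last by lra.
by apply: mulr_le0_ge0; [exact: ltW|exact: sqrtr_ge0].
Qed.
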